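(* For $n\ge1$ and positive weights $a,b,c$, let $\Phi_n^{I},\Phi_n^{II},\Phi_n^{III},\Phi_n^{IV}$ be the partition functions of dimer coverings of types I, II, III, IV of the Schreier graph $\Sigma_n$ of the Hanoi Towers group $H^{(3)}$. Then for every $n\ge1$, $$\begin{cases}\Phi_{n+1}^{I}=(\Phi_n^{I})^3\frac{1}{abc}+\Phi_n^{II}\Phi_n^{III}\Phi_n^{IV},\\ \Phi_{n+1}^{II}=(\Phi_n^{II})^3\frac1c+\Phi_n^{I}\Phi_n^{III}\Phi_n^{IV}\frac1{ab},\\ \Phi_{n+1}^{III}=(\Phi_n^{III})^3\frac1b+\Phi_n^{I}\Phi_n^{II}\Phi_n^{IV}\frac1{ac},\\ \Phi_{n+1}^{IV}=(\Phi_n^{IV})^3\frac1a+\Phi_n^{I}\Phi_n^{II}\Phi_n^{III}\frac1{bc},\end{cases}$$ with initial conditions $$\Phi_1^{I}=abc,\qquad \Phi_1^{II}=c^2,\qquad \Phi_1^{III}=b^2,\qquad \Phi_1^{IV}=a^2.$$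
   Context: The Hanoi Towers group $H^{(3)}$ is generated by the involutions $a,b,c$ acting on ternary words (over $\{0,1,2\}$), defined recursively for any ternary word $w$ by - $a(0w)=1w$, $a(1w)=0w$, $a(2w)=2a(w)$; - $b(0w)=2w$, $b(2w)=0w$, $b(1w)=1b(w)$; - $c(1w)=2w$, $c(2w)=1w$, $c(0w)=0c(w)$. The Schreier graph $\Sigma_n$ has vertex set $\{0,1,2\}^n$. For each $s\in\{a,b,c\}$ and each unordered pair $\{u,s(u)\}$ with $s(u)\ne u$, it has one edge labeled $s$. In addition it has one loop labeled $s$ at each fixed point of $s$; these are exactly a loop labeled $c$ at $0^n$, a loop labeled $b$ at $1^n$, and a loop labeled $a$ at $2^n$. A dimer covering of $\Sigma_n$ is a set of edges, loops allowed, such that every vertex lies on exactly one of them; a loop covers its single vertex. Since $3^n$ is odd, such a covering contains one or three loops. A covering is of - type I if it contains all three loops; - type II if it contains only the loop at $0^n$; - type III if it contains only the loop at $1^n$; - type IV if it contains only the loop at $2^n$. With positive weights $a,b,c$ assigned to edges (and loops) according to their label, the weight of a covering is the product of the weights of its elements, and $\Phi_n^{i}$ is the sum of the weights of the coverings of type $i$. *)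

(* Defs.v *)
From HB Require Import structures.
From mathcomp Require Import all_boot all_order all_algebra.
Set Implicit Arguments.
Unset Strict Implicit.
Unset Printing Implicit Defensive.
Import Order.TTheory GRing.Theory Num.Theory.
Local Open Scope ring_scope.

Inductive gen := Ga | Gb | Gc.

Definition gen_to_ord (s : gen) : 'I_3 :=
  match s with Ga => inord 0 | Gb => inord 1 | Gc => inord 2 end.
Definition ord_to_gen (i : 'I_3) : gen :=
  match val i with 0%N => Ga | 1%N => Gb | _ => Gc end.
Lemma gen_to_ordK : cancel gen_to_ord ord_to_gen.
Proof. by case; rewrite /ord_to_gen /= inordK. Qed.
HB.instance Definition _ := Finite.copy gen (can_type gen_to_ordK).

Definition d0 : 'I_3 := @Ordinal 3 0 isT.
Definition d1 : 'I_3 := @Ordinal 3 1 isT.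
Definition d2 : 'I_3 := @Ordinal 3 2 isT.

Fixpoint act_a (w : seq 'I_3) : seq 'I_3 :=
  if w is x :: w' then
    if x == d0 then d1 :: w'
    else if x == d1 then d0 :: w'
    else d2 :: act_a w'
  else [::].

Fixpoint act_b (w : seq 'I_3) : seq 'I_3 :=
  if w is x :: w' then
    if x == d0 then d2 :: w'
    else if x == d2 then d0 :: w'
    else d1 :: act_b w'
  else [::].

Fixpoint act_c (w : seq 'I_3) : seq 'I_3 :=
  if w is x :: w' then
    if x == d1 then d2 :: w'
    else if x == d2 then d1 :: w'
    else d0 :: act_c w'
  else [::].

Definition act_seq (s : gen) : seq 'I_3 -> seq 'I_3 :=
  match s with Ga => act_a | Gb => act_b | Gc => act_c end.

Lemma size_act_seq (s : gen) (w : seq 'I_3) : size (act_seq s w) = size w.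
Proof. by case: s; elim: w => //= x w IH; do 2!case: ifP => //= _; rewrite IH. Qed.

Notation word n := (n.-tuple 'I_3).

Lemma act_subproof (n : nat) (s : gen) (w : word n) : size (act_seq s w) == n.
Proof. by rewrite size_act_seq size_tuple. Qed.

Definition act (n : nat) (s : gen) (w : word n) : word n :=
  Tuple (act_subproof s w).

Definition const_word (n : nat) (x : 'I_3) : word n := nseq_tuple n x.

(* A label together with a set of endpoints: edges with equal endpoints but
   distinct labels stay distinct, and a loop has a single endpoint. *)
Notation edge n := (gen * {set word n})%type.

(* [set u; act s u] is the pair {u, s(u)} when s(u) <> u, and the endpoint set
   [set u] of a loop when s fixes u. *)
Definition schreier (n : nat) : {set edge n} :=
  [set (s, [set u; act s u]) | s : gen, u : word n].

Definition loops (n : nat) : {set edge n} :=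
  [set e in schreier n | #|e.2| == 1%N].

Definition dimer_covering (n : nat) (M : {set edge n}) : bool :=
  (M \subset schreier n) &&
  [forall v : word n, #|[set e in M | v \in e.2]| == 1%N].

Inductive covering_type := TypeI | TypeII | TypeIII | TypeIV.

Definition has_type (n : nat) (t : covering_type) (M : {set edge n}) : bool :=
  match t with
  | TypeI   => loops n \subset M
  | TypeII  => M :&: loops n == [set (Gc, [set const_word n d0])]
  | TypeIII => M :&: loops n == [set (Gb, [set const_word n d1])]
  | TypeIV  => M :&: loops n == [set (Ga, [set const_word n d2])]
  end.

Definition label_weight (R : realFieldType) (a b c : R) (s : gen) : R :=
  match s with Ga => a | Gb => b | Gc => c end.

Definition Phi (R : realFieldType) (a b c : R) (n : nat) (t : covering_type) : R :=
  \sum_(M : {set edge n} | dimer_covering M && has_type t M)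
    \prod_(e in M) label_weight a b c e.1.

(* Main.v *)
Require Import Defs.
From HB Require Import structures.
From mathcomp Require Import all_boot all_order all_algebra.
From mathcomp Require Import ring.
Set Implicit Arguments.
Unset Strict Implicit.
Unset Printing Implicit Defensive.
Import Order.TTheory GRing.Theory Num.Theory.
Local Open Scope ring_scope.

(* A dimer covering of Sigma_n is the same as a labeling f of the words by
   generators with f (f(v) v) = f(v): the covering edge at v is the one with
   label f(v).  Cutting words by their last letter, Sigma_(n+1) consists of three
   copies of Sigma_n in which, for each s, the s-loops of two copies are replaced
   by one s-edge joining their endpoints; the loop in the third copy, that of the
   letter fixed by s, remains.  So a covering of Sigma_(n+1) is a choice of the
   connecting edges used together with three coverings of Sigma_n having the
   prescribed loops, where every connecting edge used has been counted as two
   loops.  Parity of the number of loops in each copy leaves only two of the eight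
   choices of connecting edges.  The recurrence already holds from n = 0, where
   Sigma_0 is one vertex with three loops, and this gives the values at n = 1. *)

(** * Action of the generators on words, letter by letter *)

Definition fixed_letter (s : gen) : 'I_3 :=
  match s with Ga => d2 | Gb => d1 | Gc => d0 end.

Definition swap_letter (s : gen) (x : 'I_3) : 'I_3 :=
  match s with
  | Ga => if x == d0 then d1 else if x == d1 then d0 else d2
  | Gb => if x == d0 then d2 else if x == d2 then d0 else d1
  | Gc => if x == d1 then d2 else if x == d2 then d1 else d0
  end.

Lemma letterP (x : 'I_3) : [\/ x = d0, x = d1 | x = d2].
Proof.
case: x => [[|[|[|//]]] lt_x3]; [apply: Or31|apply: Or32|apply: Or33];
  exact: val_inj.
Qed.

Lemma swap_letterK (s : gen) : involutive (swap_letter s).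
Proof. by move=> x; case: (letterP x) => ->; case: s. Qed.

Lemma swap_letter_id (s : gen) (x : 'I_3) :
  (swap_letter s x == x) = (x == fixed_letter s).
Proof. by case: (letterP x) => ->; case: s. Qed.

Lemma act_seq_cons (s : gen) (x : 'I_3) (w : seq 'I_3) :
  act_seq s (x :: w) =
  if x == fixed_letter s then x :: act_seq s w else swap_letter s x :: w.
Proof. by case: (letterP x) => ->; case: s. Qed.

Lemma act_seq_nil (s : gen) : act_seq s [::] = [::].
Proof. by case: s. Qed.

Lemma act_seqK (s : gen) : involutive (act_seq s).
Proof.
elim=> [|x w IH]; first by rewrite !act_seq_nil.
rewrite act_seq_cons; case: ifP => [xf|xnf].
  by rewrite act_seq_cons xf IH.
by rewrite act_seq_cons -swap_letter_id swap_letterK eq_sym swap_letter_id xnf.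
Qed.

Lemma act_seq_id (s : gen) (w : seq 'I_3) :
  (act_seq s w == w) = (w == nseq (size w) (fixed_letter s)).
Proof.
elim: w => [|x w IH]; first by rewrite act_seq_nil.
rewrite act_seq_cons /=; case: ifP => [/eqP->|xnf]; rewrite !eqseq_cons.
  by rewrite !eqxx IH.
by rewrite swap_letter_id xnf.
Qed.

(** A generator changes only the first letter it does not fix, so the change reaches the last letter
    only if it passes through [w] unchanged. This is the decomposition of the graph into copies. *)
Lemma act_seq_rcons (s : gen) (w : seq 'I_3) (x : 'I_3) :
  act_seq s (rcons w x) =
  if act_seq s w == w then rcons w (swap_letter s x) else rcons (act_seq s w) x.
Proof.
elim: w => [|y w IH] /=.
  rewrite act_seq_nil eqxx /= act_seq_cons act_seq_nil -swap_letter_id.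
  by case: eqP => [->|].
rewrite !act_seq_cons; case: ifP => [/eqP yf|ynf].
  by rewrite IH eqseq_cons eqxx /=; case: ifP.
by rewrite eqseq_cons swap_letter_id ynf.
Qed.

(* Singles out one endpoint of the [s]-edge at [w]: the two endpoints differ
   in a single letter. *)
Definition lower (s : gen) (w : seq 'I_3) : bool :=
  all2 (fun x y : 'I_3 => (x <= y)%N) w (act_seq s w).

Lemma lower_total (s : gen) (w : seq 'I_3) :
  lower s w || lower s (act_seq s w).
Proof.
rewrite /lower act_seqK.
have le_refl u : all2 (fun x y : 'I_3 => (x <= y)%N) u u.
  by elim: u => //= x u ->; rewrite leqnn.
elim: w => [|x w IH]; first by rewrite act_seq_nil.
rewrite act_seq_cons; case: ifP => _ /=; first by rewrite leqnn.
by rewrite !le_refl !andbT leq_total.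
Qed.

(** With [lower_total], this gives every edge exactly one lower endpoint, the vertex of a loop being
    its own. *)
Lemma lower_anti (s : gen) (w : seq 'I_3) :
  lower s w -> lower s (act_seq s w) -> act_seq s w = w.
Proof.
rewrite /lower act_seqK; elim: w (act_seq s w) => [|x w IH] [|y u] //=.
case/andP=> lexy lewu /andP[leyx leuw]; rewrite (IH u) //.
by congr (_ :: _); apply/val_inj/eqP; rewrite eqn_leq leyx.
Qed.

Lemma lower_rcons (s : gen) (w : seq 'I_3) (x : 'I_3) :
  lower s (rcons w x) =
  if act_seq s w == w then (x <= swap_letter s x)%N else lower s w.
Proof.
have all2_rcons y u v : size u = size v ->
    all2 (fun x y : 'I_3 => (x <= y)%N) (rcons u x) (rcons v y) =
    all2 (fun x y : 'I_3 => (x <= y)%N) u v && (x <= y)%N.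
  elim: u v => [|z u IH] [|t v] //=; first by rewrite andbT.
  by case=> eq_sz; rewrite IH // andbA.
rewrite /lower act_seq_rcons; case: eqP => [fixw|_].
  rewrite all2_rcons //; suff ->: all2 (fun x y : 'I_3 => (x <= y)%N) w w by [].
  by elim: w {fixw} => //= y w ->; rewrite leqnn.
by rewrite all2_rcons ?size_act_seq // leqnn andbT.
Qed.

(** * Words of fixed length and their last letter *)

Definition fixed_word (n : nat) (s : gen) : word n := const_word n (fixed_letter s).

Lemma actK (n : nat) (s : gen) : involutive (@act n s).
Proof. by move=> w; apply: val_inj; rewrite /= act_seqK. Qed.

Lemma act_id (n : nat) (s : gen) (w : word n) :
  (act s w == w) = (w == fixed_word n s).
Proof. by rewrite -!val_eqE /= act_seq_id size_tuple. Qed.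

Definition snoc (n : nat) (w : word n) (x : 'I_3) : word n.+1 :=
  [tuple of rcons w x].

Lemma act_snoc (n : nat) (s : gen) (w : word n) (x : 'I_3) :
  act s (snoc w x) =
  if w == fixed_word n s then snoc w (swap_letter s x) else snoc (act s w) x.
Proof.
by apply: val_inj; rewrite -act_id -val_eqE /= act_seq_rcons; case: ifP.
Qed.

Lemma fixed_word_snoc (n : nat) (s : gen) :
  fixed_word n.+1 s = snoc (fixed_word n s) (fixed_letter s).
Proof.
by apply: val_inj => /=; elim: n => //= n ->.
Qed.

Definition front (n : nat) (w : word n.+1) : word n :=
  [tuple of belast (thead w) (behead w)].

Definition final (n : nat) (w : word n.+1) : 'I_3 := last (thead w) (behead w).

Lemma front_snoc (n : nat) (w : word n) (x : 'I_3) : front (snoc w x) = w.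
Proof.
apply: val_inj; case: w => [[|y w] sz]; rewrite /= /thead ?(tnth_nth d0) //=.
by rewrite belast_rcons.
Qed.

Lemma final_snoc (n : nat) (w : word n) (x : 'I_3) : final (snoc w x) = x.
Proof.
case: w => [[|y w] sz]; rewrite /final /thead ?(tnth_nth d0) //=.
by rewrite last_rcons.
Qed.

Lemma snoc_front_final (n : nat) (w : word n.+1) : snoc (front w) (final w) = w.
Proof.
by apply: val_inj; rewrite /= -lastI; case/tupleP: w => y w; rewrite theadE.
Qed.

(** * Dimer coverings as labelings of the vertices *)

Notation labeling n := {ffun word n -> gen}.

Definition valid (n : nat) (f : labeling n) : bool :=
  [forall v, f (act (f v) v) == f v].

(** The [s]-loop sits at the fixed word of [s], so this tells whether the covering contains it. *)
Definition flag (n : nat) (f : labeling n) (s : gen) : bool :=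
  f (fixed_word n s) == s.

Definition has_flags (n : nat) (phi : gen -> bool) (f : labeling n) : bool :=
  [forall s, flag f s == phi s].

Definition edge_at (n : nat) (s : gen) (v : word n) : edge n :=
  (s, [set v; act s v]).

Definition edges_of (n : nat) (f : labeling n) : {set edge n} :=
  [set edge_at (f v) v | v : word n].

Lemma edge_at_act (n : nat) (s : gen) (v : word n) :
  edge_at s (act s v) = edge_at s v.
Proof. by rewrite /edge_at actK setUC. Qed.

Lemma edge_at_inj (n : nat) (s t : gen) (u v : word n) :
  edge_at s u = edge_at t v -> s = t /\ (u = v \/ u = act s v).
Proof.
case=> <- /setP/(_ u); rewrite !inE eqxx /=.
by case: eqP => [->|_ /esym/eqP->]; split=> //; [left|right].
Qed.

Lemma edge_at_endpoint (n : nat) (s : gen) (u v : word n) :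
  v \in (edge_at s u).2 -> edge_at s u = edge_at s v.
Proof. by rewrite !inE => /orP[]/eqP-> //; rewrite edge_at_act. Qed.

Lemma schreierP (n : nat) (e : edge n) :
  reflect (exists s u, e = edge_at s u) (e \in schreier n).
Proof.
apply: (iffP imset2P) => [[s u _ _ ->]|[s [u ->]]]; first by exists s, u.
by exists s u.
Qed.

(** The edge may have been contributed by its other endpoint, but validity makes the two labels
    agree. *)
Lemma mem_edges_of (n : nat) (f : labeling n) (s : gen) (v : word n) :
  valid f -> (edge_at s v \in edges_of f) = (f v == s).
Proof.
move=> /forallP f_ok; apply/imsetP/eqP => [[u _ /edge_at_inj[->]]|<-].
  by case=> -> //; apply/eqP.
by exists v.
Qed.

Lemma edges_of_inj (n : nat) :
  {in [pred f : labeling n | valid f] &, injective (@edges_of n)}.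
Proof.
move=> f g f_ok g_ok eq_fg; apply/ffunP => v; apply/esym/eqP.
by rewrite -mem_edges_of // -eq_fg mem_edges_of.
Qed.

Lemma edges_of_covering (n : nat) (f : labeling n) :
  valid f -> dimer_covering (edges_of f).
Proof.
move=> f_ok; apply/andP; split.
  by apply/subsetP => _ /imsetP[v _ ->]; apply/schreierP; exists (f v), v.
apply/forallP => v; apply/cards1P; exists (edge_at (f v) v).
apply/setP => e; rewrite !inE; apply/andP/eqP => [[]|->].
  case/imsetP=> u _ -> /edge_at_endpoint vu.
  suff ->: f v = f u by [].
  by apply/eqP; rewrite -mem_edges_of // -vu mem_edges_of.
by rewrite mem_edges_of // eqxx !inE eqxx.
Qed.

(** Each vertex is labeled by the only edge of [M] through it; seen from the other endpoint it is
    the same edge, whence validity. *)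
Lemma covering_edges_of (n : nat) (M : {set edge n}) :
  dimer_covering M -> exists2 f, valid f & M = edges_of f.
Proof.
case/andP=> /subsetP M_sub /forallP M_cov.
(* The body is boolean so that [xchoose] can select the label. *)
have ex1 v : exists s, [forall t, (edge_at t v \in M) == (s == t)].
  have /cards1P[e eqe] := M_cov v.
  have: e \in [set e in M | v \in e.2] by rewrite eqe set11.
  rewrite inE => /andP[eM]; have /schreierP[s [u def_e]] := M_sub _ eM.
  rewrite def_e => /edge_at_endpoint def_u; exists s.
  apply/forallP => t; apply/eqP; apply/idP/eqP => [tM|<-];
    last by rewrite -def_u -def_e.
  have: edge_at t v \in [set e in M | v \in e.2] by rewrite !inE tM eqxx.
  by rewrite eqe inE def_e def_u => /eqP/edge_at_inj[].
pose f : labeling n := [ffun v => xchoose (ex1 v)].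
have fP t v : (edge_at t v \in M) = (f v == t).
  by rewrite ffunE; apply/eqP; have /forallP := xchooseP (ex1 v); apply.
have f_ok : valid f.
  by apply/forallP => v; rewrite -fP edge_at_act fP.
exists f => //; apply/setP => e; apply/idP/imsetP => [eM|[v _ ->]].
  have /schreierP[s [v def_e]] := M_sub _ eM; exists v => //.
  by move: eM; rewrite def_e fP => /eqP->.
by rewrite fP.
Qed.

Lemma edge_at_fixed (n : nat) (s : gen) :
  edge_at s (fixed_word n s) = (s, [set fixed_word n s]).
Proof.
have /eqP fix_s : act s (fixed_word n s) == fixed_word n s by rewrite act_id.
by rewrite /edge_at fix_s setUid.
Qed.

Lemma loopsP (n : nat) (e : edge n) :
  reflect (exists s, e = edge_at s (fixed_word n s)) (e \in loops n).
Proof.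
rewrite inE; apply: (iffP andP) => [[]|[s ->]].
  case/schreierP=> s [u ->] /=; rewrite cards2 eqSS eqb0 negbK eq_sym act_id.
  by move/eqP->; exists s.
split; first by apply/schreierP; exists s, (fixed_word n s).
by rewrite edge_at_fixed /= cards1.
Qed.

Definition type_flags (t : covering_type) (s : gen) : bool :=
  match t, s with
  | TypeI, _ | TypeII, Gc | TypeIII, Gb | TypeIV, Ga => true
  | _, _ => false
  end.

Lemma edges_of_one_loop (n : nat) (f : labeling n) (s : gen) :
  valid f ->
  (edges_of f :&: loops n == [set (s, [set fixed_word n s])]) =
  has_flags (eq_op s) f.
Proof.
move=> f_ok; rewrite -edge_at_fixed; apply/eqP/forallP => [eqM t|f_flags].
  rewrite /flag -mem_edges_of //; apply/eqP.
  have: (edge_at t (fixed_word n t) \in edges_of f :&: loops n) =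
        (edge_at t (fixed_word n t) == edge_at s (fixed_word n s)).
    by rewrite eqM inE.
  rewrite inE (introT (loopsP _)) ?andbT => [->|]; last by exists t.
  by apply/eqP/eqP => [/edge_at_inj[]|->].
apply/setP => e; rewrite in_setI in_set1; apply/andP/eqP => [[]|->].
  move=> + /loopsP[t def_e]; rewrite def_e mem_edges_of //.
  by have /eqP := f_flags t; rewrite /flag => -> /eqP->.
rewrite mem_edges_of //; split; last by apply/loopsP; exists s.
by have /eqP := f_flags s; rewrite /flag eqxx.
Qed.

Lemma has_type_edges_of (n : nat) (t : covering_type) (f : labeling n) :
  valid f -> has_type t (edges_of f) = has_flags (type_flags t) f.
Proof.
move=> f_ok; case: t => /=.
- apply/subsetP/forallP => [all_in s|f_flags e].
    rewrite /flag -mem_edges_of // all_in //; apply/loopsP; by exists s.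
  case/loopsP=> s ->; rewrite mem_edges_of //.
  by have /eqP := f_flags s.
- rewrite (edges_of_one_loop Gc) //; apply: eq_forallb => s.
  by congr (_ == _); case: s; apply/eqP.
- rewrite (edges_of_one_loop Gb) //; apply: eq_forallb => s.
  by congr (_ == _); case: s; apply/eqP.
- rewrite (edges_of_one_loop Ga) //; apply: eq_forallb => s.
  by congr (_ == _); case: s; apply/eqP.
Qed.

(** * Partition functions as sums over labelings *)

Section PartitionFunction.

Variables (R : realFieldType) (wt : gen -> R).

(* Each edge is counted at its lower endpoint only. *)
Definition labeling_weight (n : nat) (f : labeling n) : R :=
  \prod_(v | lower (f v) v) wt (f v).

(** Any set of loops may be prescribed, not only those of the four types, since gluing sums over all
    of them. *)
Definition Psi (n : nat) (phi : gen -> bool) : R :=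
  \sum_(f : labeling n | valid f && has_flags phi f) labeling_weight f.

(** The map from vertices to covering edges is two-to-one off the loops; restricted to lower
    endpoints it becomes a bijection. *)
Lemma weight_edges_of (n : nat) (f : labeling n) :
  valid f -> \prod_(e in edges_of f) wt e.1 = labeling_weight f.
Proof.
move=> f_ok; set L := [set v : word n | lower (f v) v].
have /forallP f_act := f_ok.
have -> : edges_of f = [set edge_at (f v) v | v in L].
  apply/setP => e; apply/imsetP/imsetP => [[v _ ->]|[v _ ->]]; last by exists v.
  have [lo|lo] := boolP (lower (f v) v); first by exists v; rewrite ?inE.
  exists (act (f v) v); last by rewrite (eqP (f_act v)) edge_at_act.
  rewrite inE (eqP (f_act v)) /=.
  by have := lower_total (f v) v; rewrite (negbTE lo).
rewrite big_imset /= => [|u v]; first by apply: eq_bigl => v; rewrite inE.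
rewrite !inE => lou lov /edge_at_inj[eq_uv [//|def_u]].
move: lou lov; rewrite -eq_uv {2}def_u => lou lov.
by rewrite def_u; apply: val_inj; apply: lower_anti.
Qed.

End PartitionFunction.

Lemma Phi_Psi (R : realFieldType) (a b c : R) (n : nat) (t : covering_type) :
  Phi a b c n t = Psi (label_weight a b c) n (type_flags t).
Proof.
pose A := [pred f : labeling n | valid f].
transitivity (\sum_(M in [set edges_of f | f in A] | has_type t M)
   \prod_(e in M) label_weight a b c e.1).
  apply: eq_bigl => M; congr (_ && _); apply/idP/imsetP => [|[f f_ok ->]].
    by case/covering_edges_of=> f f_ok ->; exists f.
  exact: edges_of_covering.
rewrite big_imset_cond; last exact: edges_of_inj.
apply: eq_big => [f|f /andP[f_ok _]]; last exact: weight_edges_of.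
by rewrite inE; apply: andb_id2l => f_ok; exact: has_type_edges_of.
Qed.

(** * Gluing three copies of the graph along the connecting edges *)

Lemma swap_letter_fixed (s : gen) : swap_letter s (fixed_letter s) = fixed_letter s.
Proof. by apply/eqP; rewrite swap_letter_id. Qed.

(* Of the two copies joined by the [s]-edge, the one with the larger letter. *)
Definition upper_letter (s : gen) : 'I_3 := if s is Ga then d1 else d2.

Lemma upper_letterE (s : gen) (x : 'I_3) :
  (x == upper_letter s) = ~~ (x <= swap_letter s x)%N.
Proof. by case: (letterP x) => ->; case: s. Qed.

Lemma letter_cases (s : gen) (x : 'I_3) :
  [\/ x = fixed_letter s, x = upper_letter s | x = swap_letter s (upper_letter s)].
Proof.
by case: (letterP x) => ->; case: s;
  first [exact: Or31 | exact: Or32 | exact: Or33].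
Qed.

Lemma upper_letter_fixed (s : gen) : (upper_letter s == fixed_letter s) = false.
Proof. by case: s. Qed.

Lemma swap_upper_letter_fixed (s : gen) :
  (swap_letter s (upper_letter s) == fixed_letter s) = false.
Proof. by case: s. Qed.

Definition glue (n : nat) (g : {ffun 'I_3 -> labeling n}) : labeling n.+1 :=
  [ffun w => g (final w) (front w)].

Lemma glue_snoc (n : nat) (g : {ffun 'I_3 -> labeling n}) (w : word n) (x : 'I_3) :
  glue g (snoc w x) = g x w.
Proof. by rewrite ffunE final_snoc front_snoc. Qed.

Lemma glue_bij (n : nat) : bijective (@glue n).
Proof.
exists (fun f : labeling n.+1 => [ffun x => [ffun w => f (snoc w x)]]) => [g|f].
  by apply/ffunP => x; apply/ffunP => w; rewrite !ffunE final_snoc front_snoc.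
by apply/ffunP => w; rewrite !ffunE snoc_front_final.
Qed.

Lemma snoc_ind (n : nat) (P : word n.+1 -> Prop) :
  (forall w x, P (snoc w x)) -> forall w, P w.
Proof. by move=> Psnoc w; rewrite -(snoc_front_final w). Qed.

Lemma flag_glue (n : nat) (g : {ffun 'I_3 -> labeling n}) (s : gen) :
  flag (glue g) s = flag (g (fixed_letter s)) s.
Proof. by rewrite /flag fixed_word_snoc glue_snoc. Qed.

(** The connecting edges used, read off in one of the two copies they join; in a valid gluing the
    other copy agrees. *)
Definition links (n : nat) (g : {ffun 'I_3 -> labeling n}) : {ffun gen -> bool} :=
  [ffun s => flag (g (upper_letter s)) s].

(* [phi] gives the loops of the level [n.+1] covering, [psi] the connecting
   edges it uses; both kinds restrict to loops of the copies of level [n]. *)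
Definition copy_flags (phi psi : gen -> bool) (x : 'I_3) (s : gen) : bool :=
  if x == fixed_letter s then phi s else psi s.

(** Where the label of a vertex moves its front, the action stays inside the copy. Where it fixes
    the front, validity is trivial within the copy and instead compares the two copies exchanged by
    that label. *)
Lemma valid_glue (n : nat) (g : {ffun 'I_3 -> labeling n}) :
  valid (glue g) =
  [forall x, valid (g x)] &&
  [forall s, flag (g (upper_letter s)) s ==
             flag (g (swap_letter s (upper_letter s))) s].
Proof.
apply/forallP/andP => [g_ok|[/forallP g_ok /forallP g_link]].
  have g_okE x w := g_ok (snoc w x).
  have link x s : flag (g x) s -> flag (g (swap_letter s x)) s.
    move/eqP => gx; have := g_okE x (fixed_word n s).
    by rewrite !glue_snoc gx act_snoc eqxx glue_snoc.
  split; apply/forallP; [move=> x|move=> s].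
    apply/forallP => w; have := g_okE x w; rewrite !glue_snoc act_snoc.
    case: (w =P _) => [fix_w _|_]; last by rewrite glue_snoc.
    by have /eqP -> : act (g x w) w == w by rewrite act_id -fix_w.
  by apply/eqP; apply/idP/idP => /link; rewrite ?swap_letterK.
elim/snoc_ind => w x; rewrite glue_snoc act_snoc.
case: (w =P _) => [fix_w|_]; rewrite glue_snoc; last by have /forallP := g_ok x; apply.
set s := g x w in fix_w *.
have link y : flag (g (swap_letter s y)) s = flag (g y) s.
  case: (letter_cases s y) => ->; rewrite ?swap_letter_fixed ?swap_letterK //;
    by rewrite (eqP (g_link s)).
by have := link x; rewrite /flag -fix_w -/s eqxx.
Qed.

(** Every loop of a copy either survives in the glued graph or is one half of a connecting edge, so
    [phi] and [psi] together prescribe all flags of the copies, and the conditions on the copies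
    become independent. *)
Lemma valid_flags_glue (n : nat) (phi : gen -> bool) (psi : {ffun gen -> bool})
    (g : {ffun 'I_3 -> labeling n}) :
  (valid (glue g) && has_flags phi (glue g)) && (links g == psi) =
  [forall x, valid (g x) && has_flags (copy_flags phi psi x) (g x)].
Proof.
rewrite valid_glue; apply/andP/forallP => [[/andP[/andP[]]]|g_ok].
  move=> /forallP g_ok /forallP g_link /forallP g_phi /eqP/ffunP g_psi x.
  rewrite g_ok; apply/forallP => s; rewrite /copy_flags -g_psi ffunE.
  case: (letter_cases s x) => ->;
    rewrite ?upper_letter_fixed ?swap_upper_letter_fixed //.
    by rewrite eqxx -flag_glue.
  by rewrite eq_sym.
have flagE s x : flag (g x) s = copy_flags phi psi x s.
  by have /andP[_ /forallP/(_ s)/eqP] := g_ok x.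
split; last first.
  by apply/eqP/ffunP => s; rewrite ffunE flagE /copy_flags upper_letter_fixed.
apply/andP; split; last first.
  by apply/forallP => s; rewrite flag_glue flagE /copy_flags eqxx.
apply/andP; split; first by apply/forallP => x; have /andP[] := g_ok x.
apply/forallP => s.
by rewrite !flagE /copy_flags upper_letter_fixed swap_upper_letter_fixed.
Qed.

Section Gluing.

Variables (R : realFieldType) (wt : gen -> R).
Hypothesis wt_neq0 : forall s, wt s != 0.

Definition link_weight (psi : gen -> bool) : R :=
  \prod_s (if psi s then wt s else 1).

Lemma big_snoc (n : nat) (F : word n.+1 -> R) :
  \prod_w F w = \prod_(x : 'I_3) \prod_(w : word n) F (snoc w x).
Proof.
rewrite pair_big /=; apply: (reindex (fun p : 'I_3 * word n => snoc p.2 p.1)).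
apply: onW_bij; exists (fun w => (final w, front w)) => [[x w]|w] /=.
  by rewrite final_snoc front_snoc.
exact: snoc_front_final.
Qed.

(** A connecting edge in use shows up as a loop in two copies, so its weight enters the left side
    twice. *)
Lemma labeling_weight_glue (n : nat) (g : {ffun 'I_3 -> labeling n}) :
  \prod_x labeling_weight wt (g x) =
  labeling_weight wt (glue g) * link_weight (links g).
Proof.
(* The link weight is distributed first over the copies and then over their words, which leaves an
   identity at each single word. *)
have -> : link_weight (links g) =
    \prod_(x : 'I_3) \prod_s (if (x == upper_letter s) && flag (g x) s then wt s else 1).
  rewrite exchange_big /=; apply: eq_bigr => s _.
  rewrite (bigD1 (upper_letter s)) //= eqxx ffunE big1 ?mulr1 // => x.
  by move/negbTE->.
rewrite {2}/labeling_weight [in RHS]big_mkcond /= big_snoc -big_split /=.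
apply: eq_bigr => x _.
have -> : \prod_s (if (x == upper_letter s) && flag (g x) s then wt s else 1) =
    \prod_(w : word n) (if (x == upper_letter (g x w)) && (w == fixed_word n (g x w))
                        then wt (g x w) else 1).
  rewrite [RHS](eq_bigr (fun w => \prod_s (if (s == g x w) &&
     ((x == upper_letter s) && (w == fixed_word n s)) then wt s else 1))).
    rewrite exchange_big /=; apply: eq_bigr => s _.
    rewrite (bigD1 (fixed_word n s)) //= big1 ?mulr1 => [|w /negbTE->]; last first.
      by rewrite !andbF.
    by rewrite eqxx andbT /flag andbC eq_sym.
  move=> w _; rewrite [RHS](bigD1 (g x w)) //= eqxx big1 ?mulr1 // => s.
  by move/negbTE->.
rewrite /labeling_weight big_mkcond -big_split /=; apply: eq_bigr => w _.
rewrite glue_snoc lower_rcons.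
have -> : (act_seq (g x w) w == w) = (w == fixed_word n (g x w)).
  by rewrite -act_id -val_eqE.
rewrite upper_letterE.
(* At the end of a loop, [w] is always lower, but [snoc w x] is not when [x] is the upper letter;
   the link factor at [w] makes up for exactly that. *)
case: (w =P _) => [fix_w|_]; last by rewrite andbF mulr1.
have -> : lower (g x w) w.
  have /eqP fixw : act (g x w) w == w by rewrite act_id -fix_w.
  have := lower_total (g x w) w.
  by rewrite -[act_seq _ _]/(val (act _ _)) fixw orbb.
by rewrite andbT; case: leqP => _; rewrite ?mulr1 ?mul1r.
Qed.

Lemma Psi_recurrence (n : nat) (phi : gen -> bool) :
  Psi wt n.+1 phi =
  \sum_(psi : {ffun gen -> bool})
    (link_weight psi)^-1 * \prod_x Psi wt n (copy_flags phi psi x).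
Proof.
rewrite {1}/Psi (reindex (@glue n)) /=; last exact/onW_bij/glue_bij.
rewrite (partition_big (@links n) predT) //=; apply: eq_bigr => psi _.
rewrite /Psi bigA_distr_big_dep big_distrr /=.
apply: eq_big => [g|g /andP[_ /eqP <-]].
  by rewrite valid_flags_glue; apply: eq_forallb.
rewrite labeling_weight_glue mulrCA mulVf ?mulr1 //.
by apply/prodf_neq0 => s _; case: ifP => // _; rewrite oner_eq0.
Qed.

End Gluing.

(** * Expanding sums over generators and over flags *)

Lemma big_gen (T : Type) (idx : T) (op : Monoid.com_law idx) (F : gen -> T) :
  \big[op/idx]_s F s = op (F Ga) (op (F Gb) (F Gc)).
Proof.
rewrite (reindex ord_to_gen) /=; last first.
  apply: onW_bij; exists gen_to_ord; last exact: gen_to_ordK.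
  by move=> x; case: (letterP x) => ->; apply: val_inj; rewrite /= inordK.
by rewrite !big_ord_recl big_ord0 Monoid.mulm1.
Qed.

Lemma forall_gen (P : pred gen) : [forall s, P s] = [&& P Ga, P Gb & P Gc].
Proof. by apply/forallP/and3P => [P_all|[Pa Pb Pc]]; [split | case]. Qed.

Definition gen_fun (T : Type) (x y z : T) (s : gen) : T :=
  match s with Ga => x | Gb => y | Gc => z end.

Lemma gen_funE (T : Type) (phi : gen -> T) :
  phi =1 gen_fun (phi Ga) (phi Gb) (phi Gc).
Proof. by case. Qed.

Lemma sum_gen_bool (V : nmodType) (F : {ffun gen -> bool} -> V) :
  \sum_psi F psi = \sum_(x : bool) \sum_(y : bool) \sum_(z : bool)
    F [ffun s => gen_fun x y z s].
Proof.
under [RHS]eq_bigr do rewrite pair_big /=.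
rewrite pair_big /=.
apply: (reindex (fun p : bool * (bool * bool) =>
                   [ffun s => gen_fun p.1 p.2.1 p.2.2 s])).
apply: onW_bij.
exists (fun psi : {ffun gen -> bool} => (psi Ga, (psi Gb, psi Gc))) => [p|psi].
  by rewrite !ffunE; case: p => [? []].
by apply/ffunP => s; rewrite ffunE -gen_funE.
Qed.

(** * The explicit recurrence, its base case and parity *)

Section Recurrence.

Variables (R : realFieldType) (wt : gen -> R).
Hypothesis wt_neq0 : forall s, wt s != 0.

Notation Psif n x y z := (Psi wt n (gen_fun x y z)).

Lemma eq_Psi (n : nat) (phi psi : gen -> bool) :
  phi =1 psi -> Psi wt n phi = Psi wt n psi.
Proof.
move=> eq_phi; apply: eq_bigl => f; congr (_ && _).
by apply: eq_forallb => s; rewrite eq_phi.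
Qed.

(** Here [l0], [l1], [l2] are the flags of the loops at the constant words of 0, 1, 2, which carry
    the labels [Gc], [Gb], [Ga]; [x], [y], [z] tell which connecting edges [Ga], [Gb], [Gc] are
    used. *)
Lemma Psi_step (n : nat) (l0 l1 l2 : bool) :
  Psif n.+1 l2 l1 l0 =
  \sum_(x : bool) \sum_(y : bool) \sum_(z : bool)
    ((if x then wt Ga else 1) * (if y then wt Gb else 1) *
     (if z then wt Gc else 1))^-1 *
    (Psif n x y l0 * Psif n x l1 z * Psif n l2 y z).
Proof.
rewrite Psi_recurrence // sum_gen_bool; apply: eq_bigr => x _.
apply: eq_bigr => y _; apply: eq_bigr => z _; congr (_^-1 * _).
  by rewrite /link_weight big_gen !ffunE /= mulrA.
rewrite !big_ord_recl big_ord0 mulr1 mulrA; congr (_ * _ * _); apply: eq_Psi;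
  by case; rewrite /copy_flags ?ffunE.
Qed.

(** The empty word is fixed by every generator and is its own lower endpoint, so a labeling is the
    choice of one loop. *)
Lemma Psi0 (phi : gen -> bool) :
  Psi wt 0 phi = \sum_(s | [forall t, (s == t) == phi t]) wt s.
Proof.
rewrite /Psi (reindex (fun s : gen => [ffun=> s] : labeling 0)) /=; last first.
  apply: onW_bij; exists (fun f : labeling 0 => f [tuple]) => [s|f].
    by rewrite ffunE.
  by apply/ffunP => v; rewrite ffunE (tuple0 v).
apply: eq_big => [s|s _]; last first.
  rewrite /labeling_weight big_mkcond (bigD1 [tuple]) //= big1 => [|v].
    by rewrite !ffunE mulr1; case: s.
  by case/eqP; apply: tuple0.
rewrite (_ : valid _ = true); last by apply/forallP => v; rewrite !ffunE.
by apply: eq_forallb => t; rewrite /flag ffunE.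
Qed.

Lemma Psi0_gen_fun (x y z : bool) :
  Psif 0 x y z =
  match x, y, z with
  | true, false, false => wt Ga
  | false, true, false => wt Gb
  | false, false, true => wt Gc
  | _, _, _ => 0
  end.
Proof.
rewrite Psi0 big_mkcond big_gen !forall_gen /=.
have -> : (Ga == Gb) = false by apply/eqP.
have -> : (Ga == Gc) = false by apply/eqP.
have -> : (Gb == Ga) = false by apply/eqP.
have -> : (Gb == Gc) = false by apply/eqP.
have -> : (Gc == Ga) = false by apply/eqP.
have -> : (Gc == Gb) = false by apply/eqP.
by rewrite !eqxx; case: x; case: y; case: z => /=; rewrite ?addr0 ?add0r.
Qed.

(* A covering of [3 ^ n] vertices has an odd number of loops. *)
Lemma Psi_even (n : nat) (x y z : bool) : ~~ (x (+) y (+) z) -> Psif n x y z = 0.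
Proof.
elim: n x y z => [|n IH] x y z evn;
  first by rewrite Psi0_gen_fun; case: x y z evn => [] [] [].
rewrite Psi_step big1 // => x' _; rewrite big1 // => y' _; rewrite big1 // => z' _.
(* Each of [x'], [y'], [z'] occurs in two copies and cancels in the sum of the three parities; three
   odd copies would make [x (+) y (+) z] odd. *)
have [odd0|/IH->] := boolP (x' (+) y' (+) z); last by rewrite !mul0r mulr0.
have [odd1|/IH->] := boolP (x' (+) y (+) z'); last by rewrite mulr0 mul0r mulr0.
have [odd2|/IH->] := boolP (x (+) y' (+) z'); last by rewrite !mulr0.
by case: x y z x' y' z' evn odd0 odd1 odd2 => [] [] [] [] [] [].
Qed.

(** Oddness in each copy fixes the pairwise sums of [x], [y], [z], so exactly two complementary
    choices survive: one yields the cube, the other the mixed product. *)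
Lemma Psi_step_odd (n : nat) :
  [/\ Psif n.+1 true true true =
        Psif n true true true ^+ 3 * (1 / (wt Ga * wt Gb * wt Gc)) +
        Psif n false false true * Psif n false true false * Psif n true false false,
      Psif n.+1 false false true =
        Psif n false false true ^+ 3 * (1 / wt Gc) +
        Psif n true true true * Psif n false true false * Psif n true false false *
          (1 / (wt Ga * wt Gb)),
      Psif n.+1 false true false =
        Psif n false true false ^+ 3 * (1 / wt Gb) +
        Psif n true true true * Psif n false false true * Psif n true false false *
          (1 / (wt Ga * wt Gc))
    & Psif n.+1 true false false =
        Psif n true false false ^+ 3 * (1 / wt Ga) +
        Psif n true true true * Psif n false false true * Psif n false true false *
          (1 / (wt Gb * wt Gc))].
Proof.
have [a_neq0 [b_neq0 c_neq0]] := (wt_neq0 Ga, (wt_neq0 Gb, wt_neq0 Gc)).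
by split; rewrite Psi_step !big_bool /= ?[Psif n true true false]Psi_even
  ?[Psif n true false true]Psi_even ?[Psif n false true true]Psi_even
  ?[Psif n false false false]Psi_even //; field; rewrite ?a_neq0 ?b_neq0 ?c_neq0.
Qed.

End Recurrence.

Theorem theorem3p1 (R : realFieldType) (a b c : R)
    (ha : 0 < a) (hb : 0 < b) (hc : 0 < c) :
  (forall n : nat, (1 <= n)%N ->
    [/\ Phi a b c n.+1 TypeI =
          Phi a b c n TypeI ^+ 3 * (1 / (a * b * c))
          + Phi a b c n TypeII * Phi a b c n TypeIII * Phi a b c n TypeIV,
        Phi a b c n.+1 TypeII =
          Phi a b c n TypeII ^+ 3 * (1 / c)
          + Phi a b c n TypeI * Phi a b c n TypeIII * Phi a b c n TypeIV
            * (1 / (a * b)),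
        Phi a b c n.+1 TypeIII =
          Phi a b c n TypeIII ^+ 3 * (1 / b)
          + Phi a b c n TypeI * Phi a b c n TypeII * Phi a b c n TypeIV
            * (1 / (a * c))
      & Phi a b c n.+1 TypeIV =
          Phi a b c n TypeIV ^+ 3 * (1 / a)
          + Phi a b c n TypeI * Phi a b c n TypeII * Phi a b c n TypeIII
            * (1 / (b * c))]) /\
  [/\ Phi a b c 1 TypeI = a * b * c,
      Phi a b c 1 TypeII = c ^+ 2,
      Phi a b c 1 TypeIII = b ^+ 2
    & Phi a b c 1 TypeIV = a ^+ 2].
Proof.
have a_neq0 := lt0r_neq0 ha; have b_neq0 := lt0r_neq0 hb.
have c_neq0 := lt0r_neq0 hc.
have wt_neq0 s : label_weight a b c s != 0 by case: s.
have PhiE n t : Phi a b c n t = Psi (label_weight a b c) n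
    (gen_fun (type_flags t Ga) (type_flags t Gb) (type_flags t Gc)).
  by rewrite Phi_Psi; apply: eq_Psi; apply: gen_funE.
split=> [n _|]; rewrite !PhiE /=; first exact: Psi_step_odd.
(* At level 0 the types I, II, III, IV have the values 0, [c], [b], [a]. *)
have [-> -> -> ->] := Psi_step_odd wt_neq0 0.
by rewrite !Psi0_gen_fun /=; split; field; rewrite ?a_neq0 ?b_neq0 ?c_neq0.
Qed.
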